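(* Let $a>0$ and $0\le \ell\le a$ be integers. Then, as formal power series in $u$ and $t$ (with coefficients in $\mathbb{Q}[q]$), $$\sum_{n\ge 0}\frac{u^n}{n!}\,\frac{{}^{\mathrm{maj}}A_{a,\ell,n}(t,q)}{(t;q)_{n+1}}=\sum_{s\ge 0}t^s e^{u(a[s+1]_q-\ell)}.$$
   Context: Colored permutations. Let $a\ge 1$, $\alpha=e^{2\pi i/a}$, $C_a=\{\alpha^v: 0\le v\le a-1\}$. For $n\ge 1$, $C_a\wr S_n$ is the group of all permutations $\sigma$ of the set $\{\alpha^v j: 0\le v\le a-1,\ 1\le j\le n\}$ with $\sigma(\beta j)=\beta\sigma(j)$ for all $\beta\in C_a$, $1\le j\le n$. Such $\sigma$ is written in window notation $\sigma=[\sigma(1),\dots,\sigma(n)]$; the absolute values $|\sigma(1)|,\dots,|\sigma(n)|$ form a permutation of $\{1,\dots,n\}$. For $n=0$, $C_a\wr S_0$ consists of the single empty window, with descent number and reverse major index $0$. The order $<_L$. Let $L\subseteq\{0,\dots,a-1\}$ and $U=\{0,\dots,a-1\}\setminus L$. The linear order $<_L$ on $\{\alpha^v j: 0\le v\le a-1,\ 1\le j\le n\}\cup\{0\}$ is determined by: $\alpha^v j<_L 0$ for $v\in L$; $\alpha^v j>_L 0$ for $v\in U$; for $u,v\in L$ (not necessarily distinct) and $i\ne j$, $\alpha^v i<_L\alpha^u j$ iff $i>j$; for $u,v\in U$ (not necessarily distinct) and $i\neq j$, $\alpha^v i<_L\alpha^u j$ iff $i<j$; and for each $j$ the sets $\{\alpha^v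 j: v\in L\}$ and $\{\alpha^v j: v\in U\}$ are each ordered in an arbitrary fixed linear order. Statistics. For $\sigma\in C_a\wr S_n$ put $\sigma(0):=0$ and define $\mathrm{Des}_L(\sigma)=\{0\le i\le n-1:\sigma(i)>_L\sigma(i+1)\}$, $\mathrm{des}_L(\sigma)=|\mathrm{Des}_L(\sigma)|$, and $\mathrm{rmaj}_{L,n}(\sigma)=\sum_{i\in \mathrm{Des}_L(\sigma)}(n-i)$. Polynomials. ${}^{\mathrm{maj}}A_{a,L,n}(t,q)=\sum_{\sigma\in C_a\wr S_n}t^{\mathrm{des}_L(\sigma)}q^{\mathrm{rmaj}_{L,n}(\sigma)}$. This polynomial depends on $L$ only through $|L|$; for $0\le\ell\le a$, ${}^{\mathrm{maj}}A_{a,\ell,n}(t,q)$ denotes ${}^{\mathrm{maj}}A_{a,L,n}(t,q)$ for any $L$ with $|L|=\ell$. In particular ${}^{\mathrm{maj}}A_{a,\ell,0}(t,q)=1$. $q$-notation. $[m]_q=1+q+\cdots+q^{m-1}$ for $m\ge1$; $(t;q)_0=1$ and $(t;q)_m=(1-t)(1-tq)\cdots(1-tq^{m-1})$ for $m>0$. *)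

(* Defs.v *)
From HB Require Import structures.
From mathcomp Require Import all_boot all_order all_algebra.
From mathcomp Require Import perm boolp.

Set Implicit Arguments.
Unset Strict Implicit.
Unset Printing Implicit Defensive.

Import Order.TTheory GRing.Theory Num.Theory.
Local Open Scope ring_scope.

(** * Formal power series in one variable.
    Series in u and t are [{fps {fps R}}]: the outer variable is u, the inner
    one is t, so [F n m] is the coefficient of u^n t^m. *)

Record fps (R : Type) := Fps { fps_coef :> nat -> R }.

Notation "{ 'fps' R }" := (fps R) (format "{ 'fps'  R }") : type_scope.

HB.instance Definition _ (R : Type) := gen_eqMixin {fps R}.
HB.instance Definition _ (R : Type) := gen_choiceMixin {fps R}.

Lemma fpsP (R : Type) (f g : {fps R}) : (forall n, f n = g n) -> f = g.
Proof. by case: f g => [f] [g] /= /funext ->. Qed.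

Section FpsZmodule.
Variable R : zmodType.
Implicit Types f g h : {fps R}.

Definition fps_zero : {fps R} := Fps (fun=> 0).
Definition fps_opp f : {fps R} := Fps (fun n => - f n).
Definition fps_add f g : {fps R} := Fps (fun n => f n + g n).

Fact fps_addA : associative fps_add.
Proof. by move=> f g h; apply: fpsP => n /=; rewrite addrA. Qed.
Fact fps_addC : commutative fps_add.
Proof. by move=> f g; apply: fpsP => n /=; rewrite addrC. Qed.
Fact fps_add0 : left_id fps_zero fps_add.
Proof. by move=> f; apply: fpsP => n /=; rewrite add0r. Qed.
Fact fps_addN : left_inverse fps_zero fps_opp fps_add.
Proof. by move=> f; apply: fpsP => n /=; rewrite addNr. Qed.

HB.instance Definition _ :=
  GRing.isZmodule.Build {fps R} fps_addA fps_addC fps_add0 fps_addN.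

End FpsZmodule.

Section FpsRing.
Variable R : comNzRingType.
Implicit Types f g h : {fps R}.

Definition fpsC (c : R) : {fps R} := Fps (fun n => if n is 0 then c else 0).

Definition fps_mul f g : {fps R} :=
  Fps (fun n => \sum_(i < n.+1) f i * g (n - i)%N).

Fact fps_mul_rev f g n :
  \sum_(i < n.+1) f i * g (n - i)%N = \sum_(i < n.+1) f (n - i)%N * g i.
Proof.
rewrite (reindex_inj rev_ord_inj) /=.
by apply: eq_bigr => i _; rewrite subSS subKn // -ltnS.
Qed.

Fact fps_mulC : commutative fps_mul.
Proof.
move=> f g; apply: fpsP => n /=; rewrite fps_mul_rev.
by apply: eq_bigr => i _; rewrite mulrC.
Qed.

Fact fps_mulA : associative fps_mul.
Proof.
move=> f g h; apply: fpsP => n /=; rewrite (fps_mul_rev (fps_mul f g)).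
pose c j k := f j * (g (n - j - k)%N * h k).
transitivity (\sum_(j < n.+1) \sum_(k < n.+1 | (k <= n - j)%N) c j k).
  apply: eq_bigr => /= j _; rewrite fps_mul_rev big_distrr /=.
  by rewrite (big_ord_narrow_leq (leq_subr _ _)).
rewrite (exchange_big_dep predT) //=; apply: eq_bigr => k _.
transitivity (\sum_(j < n.+1 | (j <= n - k)%N) c j k).
  apply: eq_bigl => j; rewrite -ltnS -(ltnS j) -!subSn ?leq_ord //.
  by rewrite -subn_gt0 -(subn_gt0 j) -!subnDA addnC.
rewrite (big_ord_narrow_leq (leq_subr _ _)) big_distrl /=.
by apply: eq_bigr => j _; rewrite /c -!subnDA addnC mulrA.
Qed.

Fact fps_mul1 : left_id (fpsC 1) fps_mul.
Proof.
move=> f; apply: fpsP => n /=; rewrite big_ord_recl /= mul1r subn0.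
by rewrite big1 ?addr0 // => i _; rewrite mul0r.
Qed.

Fact fps_mulDl : left_distributive fps_mul +%R.
Proof.
move=> f g h; apply: fpsP => n /=; rewrite -big_split /=.
by apply: eq_bigr => i _; rewrite mulrDl.
Qed.

Fact fps_1neq0 : fpsC 1 != 0.
Proof.
by apply/eqP => /(congr1 (fun f : {fps R} => f 0%N)) /eqP; rewrite /= oner_eq0.
Qed.

HB.instance Definition _ :=
  GRing.Zmodule_isComNzRing.Build {fps R}
    fps_mulA fps_mulC fps_mul1 fps_mulDl fps_1neq0.

Definition fpsX : {fps R} := Fps (fun n => (n == 1%N)%:R).

Definition fps_of_poly (p : {poly R}) : {fps R} := Fps (fun n => p`_n).

End FpsRing.

Arguments fpsX {R}.

Section FpsUnitRing.
Variable R : comUnitRingType.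
Implicit Types f g : {fps R}.

Definition fps_unit : {pred {fps R}} := fun f => f 0%N \is a GRing.unit.

(* The first n+1 coefficients of 1/f, solved from f * (1/f) = 1. *)
Fixpoint fps_inv_seq f n : seq R :=
  if n is m.+1 then
    let s := fps_inv_seq f m in
    rcons s (- (f 0%N)^-1 * \sum_(i < m.+1) s`_i * f (m.+1 - i)%N)
  else [:: (f 0%N)^-1].

Definition fps_inv f : {fps R} :=
  if f \in fps_unit then Fps (fun n => (fps_inv_seq f n)`_n) else f.

Lemma size_fps_inv_seq f n : size (fps_inv_seq f n) = n.+1.
Proof. by elim: n => //= n IHn; rewrite size_rcons IHn. Qed.

Lemma nth_fps_inv_seq f n i :
  (i <= n)%N -> (fps_inv_seq f n)`_i = (fps_inv_seq f i)`_i.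
Proof.
elim: n => [|n IHn]; first by rewrite leqn0 => /eqP->.
rewrite leq_eqVlt => /orP[/eqP-> //|lt_in].
by rewrite /= nth_rcons size_fps_inv_seq lt_in IHn.
Qed.

Fact fps_mulVx : {in fps_unit, left_inverse 1 fps_inv *%R}.
Proof.
move=> f Uf; rewrite /fps_inv Uf; apply: fpsP => -[|n].
  by rewrite /= big_ord_recl big_ord0 addr0 /= mulVr.
rewrite [LHS]/= big_ord_recr /= subnn nth_rcons size_fps_inv_seq ltnn eqxx.
rewrite mulrAC mulNr mulVr // mulN1r; apply/eqP; rewrite subr_eq0; apply/eqP.
by apply: eq_bigr => i _; rewrite (@nth_fps_inv_seq f n i) -1?ltnS.
Qed.

Fact fps_unitPl f g : g * f = 1 -> fps_unit f.
Proof.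
move=> /(congr1 (fun h : {fps R} => h 0%N)); rewrite /= big_ord_recl big_ord0.
by rewrite addr0 /= => gf1; apply/unitrPr; exists (g 0%N); rewrite mulrC.
Qed.

Fact fps_invr_out : {in [predC fps_unit], fps_inv =1 id}.
Proof. by move=> f; rewrite inE /fps_inv /= => /negPf->. Qed.

HB.instance Definition _ :=
  GRing.ComNzRing_hasMulInverse.Build {fps R}
    fps_mulVx fps_unitPl fps_invr_out.

(* e^(u c), as a series in u. *)
Definition fps_exp (c : R) : {fps R} := Fps (fun n => c ^+ n / n`!%:R).

End FpsUnitRing.

(* The infinite sum of the F k converges to S in the topology of formal power
   series: each coefficient of the partial sums is eventually that of S. *)
Definition fps_has_sum (R : comNzRingType)
    (F : nat -> {fps {fps R}}) (S : {fps {fps R}}) : Prop :=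
  forall n m, exists N, forall k, (N <= k)%N -> (\sum_(i < k) F i) n m = S n m.

Lemma fps_has_sum_unique (R : comNzRingType)
    (F : nat -> {fps {fps R}}) (S S' : {fps {fps R}}) :
  fps_has_sum F S -> fps_has_sum F S' -> S = S'.
Proof.
move=> FS FS'; apply: fpsP => n; apply: fpsP => m.
have [N FN] := FS n m; have [N' FN'] := FS' n m.
by rewrite -(FN (maxn N N')) ?leq_maxl // FN' // leq_maxr.
Qed.

(** * Colored permutations *)

(* (v, j) stands for the letter alpha^v (j + 1). *)
Definition letter a n : finType := ('I_a * 'I_n)%type.

Definition color0 a (a_gt0 : (0 < a)%N) : 'I_a := Ordinal a_gt0.

(* (w, x) |-> alpha^w x *)
Definition rotate a n (a_gt0 : (0 < a)%N) (w : 'I_a) (x : letter a n) :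
    letter a n :=
  (Ordinal (ltn_pmod (w + x.1) a_gt0), x.2).

Definition colored_perms a (a_gt0 : (0 < a)%N) n : {set {perm letter a n}} :=
  [set s : {perm letter a n} | [forall w : 'I_a, forall j : 'I_n,
     s (rotate a_gt0 w (color0 a_gt0, j))
       == rotate a_gt0 w (s (color0 a_gt0, j))]].

(* A strict linear order <_L on the letters and 0, where 0 is [None]. *)
Record colored_order a n (L : {set 'I_a}) (lt : rel (option (letter a n))) :
    Prop := ColoredOrder {
  colored_irr : irreflexive lt;
  colored_trans : transitive lt;
  colored_total : forall x y, x != y -> lt x y || lt y x;
  colored_L0 : forall v j, v \in L -> lt (Some (v, j)) None;
  colored_0U : forall v j, v \notin L -> lt None (Some (v, j));
  colored_LL : forall u v i j, u \in L -> v \in L -> i != j ->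
    lt (Some (v, i)) (Some (u, j)) = (j < i)%N;
  colored_UU : forall u v i j, u \notin L -> v \notin L -> i != j ->
    lt (Some (v, i)) (Some (u, j)) = (i < j)%N }.

Lemma colored_order_exists a n (L : {set 'I_a}) :
  exists lt : rel (option (letter a n)), colored_order L lt.
Proof.
pose key (x : option (letter a n)) : int :=
  if x is Some (v, j) then
    if v \in L then - (j.+1 * a + v)%N%:Z else (j.+1 * a + v)%N%:Z
  else 0.
have pos (v : 'I_a) (j : nat) : (0 < j.+1 * a + v)%N.
  by rewrite mulSn -addnA addn_gt0 (leq_ltn_trans _ (ltn_ord v)).
have enc (u v : 'I_a) (i j : nat) :
    (i < j)%N -> (i.+1 * a + v < j.+1 * a + u)%N.
  move=> lt_ij; apply: (@leq_trans (i.+2 * a)%N); last first.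
    by rewrite (leq_trans _ (leq_addr _ _)) // leq_mul2r !ltnS lt_ij orbT.
  by rewrite [(i.+2 * a)%N]mulSn addnC ltn_add2r.
have encE (u v : 'I_a) (i j : 'I_n) : i != j ->
    (i.+1 * a + v < j.+1 * a + u)%N = (i < j)%N.
  move=> ne_ij; case: (ltngtP i j) => [/enc->//|/enc lt_ji|/val_inj e].
    by apply/negbTE; rewrite -leqNgt ltnW.
  by rewrite e eqxx in ne_ij.
have inj_enc (u v : 'I_a) (i j : 'I_n) :
    (i.+1 * a + v = j.+1 * a + u)%N -> (v, i) = (u, j).
  move=> e; case: (ltngtP i j) => [/(enc u v)|/(enc v u)|/val_inj e_ij].
  - by rewrite e ltnn.
  - by rewrite e ltnn.
  - by move: e; rewrite e_ij => /addnI /val_inj ->.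
have key_inj : injective key.
  move=> [[v i]|] [[u j]|] //=.
  - case: ifP => _; case: ifP => _.
    + by move=> /oppr_inj [] /inj_enc ->.
    + move=> e; have := pos u j; rewrite -ltz_nat -e oppr_gt0.
      by rewrite ltz_nat.
    + move=> e; have := pos v i; rewrite -ltz_nat e oppr_gt0.
      by rewrite ltz_nat.
    + by move=> [] /inj_enc ->.
  - by have := pos v i; case: ifP => _ p /eqP; rewrite ?oppr_eq0 => /eqP[] e;
      rewrite e in p.
  - by have := pos u j; case: ifP => _ p /esym/eqP; rewrite ?oppr_eq0 => /eqP[] e;
      rewrite e in p.
exists (fun x y => key x < key y); split.
- by move=> x; rewrite ltxx.
- by move=> y x z; apply: lt_trans.
- by move=> x y ne_xy; rewrite -neq_lt (inj_eq key_inj).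
- by move=> v j /= ->; rewrite oppr_lt0 ltz_nat pos.
- by move=> v j /= /negPf->; rewrite ltz_nat pos.
- move=> u v i j /= -> -> ne_ij.
  by rewrite ltrN2 ltz_nat encE // eq_sym.
- by move=> u v i j /= /negPf-> /negPf-> ne_ij; rewrite ltz_nat encE.
Qed.

Section Statistics.
Variables (a : nat) (a_gt0 : (0 < a)%N) (n : nat).
Variable lt : rel (option (letter a n)).
Implicit Type s : {perm letter a n}.

(* sigma(i) for 0 <= i <= n, with sigma(0) = 0; since [letter] counts from 0,
   sigma(k + 1) is read off at (0, k).  The value for i > n is irrelevant. *)
Definition window s (i : nat) : option (letter a n) :=
  if i is k.+1 then omap (fun j : 'I_n => s (color0 a_gt0, j)) (insub k)
  else None.

Definition Des s : {set 'I_n} :=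
  [set i : 'I_n | lt (window s i.+1) (window s i)].

Definition des s : nat := #|Des s|.

Definition rmaj s : nat := \sum_(i in Des s) (n - i).

(* Polynomials in t over Q[q]: the outer 'X is t, the inner one is q. *)
Definition majA : {poly {poly rat}} :=
  \sum_(s in colored_perms a_gt0 n) 'X^(des s) * ('X^(rmaj s))%:P.

End Statistics.

(* [m]_q *)
Definition qint (m : nat) : {poly rat} := \sum_(i < m) 'X^i.

(* (t;q)_m *)
Definition qpoch (m : nat) : {poly {poly rat}} :=
  \prod_(i < m) (1 - 'X * ('X^i)%:P).

(* Main.v *)
Require Import Defs.
From HB Require Import structures.
From mathcomp Require Import all_boot all_order all_algebra.
From mathcomp Require Import perm ring.

Set Implicit Arguments.
Unset Strict Implicit.
Unset Printing Implicit Defensive.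

Import Order.TTheory GRing.Theory Num.Theory.
Local Open Scope ring_scope.

(** The coefficient of u^n/n! t^s on the right is (a[s+1]_q - l)^n, so the claim
    is, for each n,
      majA_n(t,q) / (t;q)_(n+1) = sum_s t^s (a[s+1]_q - l)^n.
    A colored permutation amounts to a color c(j) for each j together with an
    ordering of the n letters T = {(c(j), j)} ([majA_words]).  The order <_L is
    linear on T and 0, and the letters below 0 are those with c(j) in L.

    In general, let T be a finite set in a linear order and x an element outside
    T; weight the words w enumerating T by t^des q^rmaj, where a descent from x
    to the first letter of w is counted as well.  The heart of the proof
    ([sum_word_stat]) is
      sum_w t^des(w) q^rmaj(w)
        = (t;q)_(|T|+1) * sum_s t^s prod_(y in T) ([s+1]_q - [y < x]).
    With x = 0 the product over T equals prod_j ([s+1]_q - [c(j) in L]), and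
    summing over all colorings c turns it into (a[s+1]_q - l)^n
    ([majA_series]).

    The formula for words is proved by induction on |T|, splitting off the first
    letter y of w.  Position 0 contributes (t q^|T|)^[y < x] and the rest is a
    word on T \ y compared with y, so for nonempty T what has to be shown is
      (1 - t q^|T|) S(T, x) = sum_(y in T) (t q^|T|)^[y < x] S(T \ y, y)
    for the series S(T, x) on the right ([slot_series_rec]).  Coefficientwise,
    the letters above x and those below x each give a telescoping sum: passing
    from y to the next larger letter changes one factor of
    prod_z (A - [z < y]) from A to A - 1.  The two sums match because
    [s+2]_q - 1 = q [s+1]_q. *)

(** * Coefficients of formal power series *)

Section Coefficients.
Variable R : comNzRingType.
Implicit Types (f : {fps R}) (p : {poly R}) (c : R).

Lemma fps_sumE (I : Type) (r : seq I) (P : pred I) (F : I -> {fps R}) n :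
  (\sum_(i <- r | P i) F i) n = \sum_(i <- r | P i) F i n.
Proof. by apply: (big_morph (fun f : {fps R} => f n)). Qed.

Lemma coef_fpsCM c f n : (fpsC c * f) n = c * f n.
Proof.
by rewrite /= big_ord_recl subn0 /= big1 ?addr0 // => i _; rewrite mul0r.
Qed.

Lemma coef_fpsXM f n : (fpsX * f) n = if n is m.+1 then f m else 0.
Proof.
case: n => [|n] /=; first by rewrite big_ord_recl big_ord0 /= mul0r addr0.
rewrite !big_ord_recl /= mul0r add0r mul1r subSS subn0.
by rewrite big1 ?addr0 // => i _; rewrite mul0r.
Qed.

Lemma coef_fpsXnM k f n :
  (fpsX ^+ k * f) n = if (k <= n)%N then f (n - k)%N else 0.
Proof.
elim: k n => [|k IHk] n; first by rewrite expr0 mul1r subn0.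
by rewrite exprS -mulrA coef_fpsXM; case: n => // n; rewrite IHk.
Qed.

Fact fpsC_is_zmod_morphism : zmod_morphism (@fpsC R).
Proof. by move=> c d; apply: fpsP => -[|n] //=; rewrite subrr. Qed.
Fact fpsC_is_monoid_morphism : monoid_morphism (@fpsC R).
Proof.
split=> // c d; apply: fpsP => n; rewrite coef_fpsCM.
by case: n => //= n; rewrite mulr0.
Qed.
HB.instance Definition _ :=
  GRing.isZmodMorphism.Build R {fps R} (@fpsC R) fpsC_is_zmod_morphism.
HB.instance Definition _ :=
  GRing.isMonoidMorphism.Build R {fps R} (@fpsC R) fpsC_is_monoid_morphism.

Fact fps_of_poly_is_zmod_morphism : zmod_morphism (@fps_of_poly R).
Proof. by move=> p p'; apply: fpsP => n /=; rewrite coefB. Qed.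
Fact fps_of_poly_is_monoid_morphism : monoid_morphism (@fps_of_poly R).
Proof.
split=> [|p p']; apply: fpsP => n /=; last by rewrite coefM.
by rewrite coef1; case: n.
Qed.
HB.instance Definition _ :=
  GRing.isZmodMorphism.Build {poly R} {fps R} (@fps_of_poly R)
    fps_of_poly_is_zmod_morphism.
HB.instance Definition _ :=
  GRing.isMonoidMorphism.Build {poly R} {fps R} (@fps_of_poly R)
    fps_of_poly_is_monoid_morphism.

Lemma fps_of_polyX : fps_of_poly 'X = fpsX :> {fps R}.
Proof. by apply: fpsP => n /=; rewrite coefX. Qed.

Lemma fps_of_polyC c : fps_of_poly c%:P = fpsC c.
Proof. by apply: fpsP => -[|n] /=; rewrite coefC. Qed.

Lemma coef_fps_of_XCM c f n :
  (fps_of_poly ('X * c%:P) * f) n = if n is m.+1 then c * f m else 0.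
Proof.
have -> : fps_of_poly ('X * c%:P) = fpsX * fpsC c.
  by rewrite rmorphM /= fps_of_polyX fps_of_polyC.
rewrite -mulrA coef_fpsXM.
by case: n => // n; rewrite coef_fpsCM.
Qed.

End Coefficients.

(** * A telescoping identity along a linear order *)

Section Telescoping.
Variables (X : eqType) (lt : rel X).
Hypotheses (lt_irr : irreflexive lt) (lt_trans : transitive lt).
Hypothesis lt_total : forall x y, x != y -> lt x y || lt y x.
Variable R : comNzRingType.
Implicit Types (x y z : X) (T : seq X) (A : R).

Let le x y := (x == y) || lt x y.

Let le_total : total le.
Proof.
by move=> x y; rewrite /le; case: eqVneq => //= /lt_total.
Qed.

Let le_trans : transitive le.
Proof.
move=> y x z /orP[/eqP->//|lt_xy] /orP[/eqP<-|lt_yz]; rewrite /le.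
  by rewrite lt_xy orbT.
by rewrite (lt_trans lt_xy lt_yz) orbT.
Qed.

Lemma strict_asym x y : lt x y -> lt y x = false.
Proof.
move=> lt_xy; apply/negP => lt_yx.
by have := lt_trans lt_xy lt_yx; rewrite lt_irr.
Qed.

Lemma strict_connex x y : x != y -> lt x y = false -> lt y x.
Proof. by move=> /lt_total; case: (lt x y). Qed.

(** Replace the factors a z by b z one at a time, from the smallest z upwards:
    the step at y changes the product by the y-th summand on the left.  Both
    sides depend on T only as a multiset, so T may be sorted. *)
Lemma telescope_prod (a b : X -> R) T : uniq T ->
  \sum_(y <- T) (a y - b y) *
     \prod_(z <- T | z != y) (if lt z y then b z else a z)
  = \prod_(z <- T) a z - \prod_(z <- T) b z.
Proof.
move=> uT; have eqT : perm_eq T (sort le T) by rewrite perm_sym perm_sort.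
rewrite !(perm_big _ eqT) /=; under eq_bigr do rewrite (perm_big _ eqT) /=.
have: pairwise le (sort le T).
  by rewrite -(sorted_pairwise le_trans) sort_sorted.
have: uniq (sort le T) by rewrite sort_uniq.
elim: (sort le T) => [|m S IH] /=; first by rewrite !big_nil subrr.
case/andP=> mS uS /andP[/allP le_m pS].
have lt_m z : z \in S -> lt m z.
  by move=> zS; have /orP[/eqP e|//] := le_m _ zS; rewrite e zS in mS.
have neq_m z : z \in S -> (z != m) by apply: contraTneq => ->.
rewrite !big_cons eqxx /=.
have -> : \prod_(z <- S | z != m) (if lt z m then b z else a z)
          = \prod_(z <- S) a z.
  rewrite big_seq_cond [RHS]big_seq; apply: eq_big => z.
    by case zS: (z \in S); rewrite //= neq_m.
  by case/andP=> /lt_m /strict_asym ->.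
rewrite (_ : \sum_(y <- S) _ = b m * (\prod_(z <- S) a z - \prod_(z <- S) b z)).
  by ring.
rewrite -IH // big_distrr /=; apply: eq_big_seq => y yS.
by rewrite big_cons eq_sym neq_m // lt_m // mulrCA.
Qed.

(** Telescoping from A - [z < x] to A - 1: only the factors at letters above x
    change, each of them by 1. *)
Lemma sum_prod_above x T A : uniq T -> x \notin T ->
  \sum_(y <- T) (if lt y x then 0 else
      \prod_(z <- rem y T) (A - (lt z y)%:R))
  = \prod_(z <- T) (A - (lt z x)%:R) - \prod_(z <- T) (A - 1).
Proof.
move=> uT xT; rewrite -telescope_prod //; apply: eq_big_seq => y yT.
have neq_yx : y != x by apply: contraNneq xT => <-.
case: ifPn => [_|/negbTE/(strict_connex neq_yx) lt_xy].
  by rewrite subrr mul0r.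
rewrite subr0 opprB addrC subrK mul1r rem_filter // big_filter.
rewrite big_seq_cond [RHS]big_seq_cond; apply: eq_bigr => z /andP[_ neq_zy].
case: ifPn => // /negbTE/(strict_connex neq_zy) lt_yz.
by rewrite (strict_asym (lt_trans lt_xy lt_yz)).
Qed.

(** Telescoping from A to A - [z < x]: only the factors at letters below x
    change, each of them by 1. *)
Lemma sum_prod_below x T A : uniq T ->
  \sum_(y <- T) (if lt y x then
      \prod_(z <- rem y T) (A - (lt z y)%:R) else 0)
  = \prod_(z <- T) A - \prod_(z <- T) (A - (lt z x)%:R).
Proof.
move=> uT; rewrite -telescope_prod //; apply: eq_big_seq => y yT.
case: ifP => [lt_yx|_]; last by rewrite subr0 subrr mul0r.
rewrite opprB addrC subrK mul1r rem_filter // big_filter.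
apply: eq_bigr => z _; case: ifP => [lt_zy|_]; last by rewrite subr0.
by rewrite (lt_trans lt_zy lt_yx).
Qed.

End Telescoping.

(** * Words on a linearly ordered alphabet *)

Lemma qintS m : qint m.+1 = 1 + 'X * qint m.
Proof.
rewrite /qint big_ord_recl expr0 big_distrr /=; congr (_ + _).
by apply: eq_bigr => i _; rewrite -exprS.
Qed.

Lemma qpochS m : qpoch m.+1 = qpoch m * (1 - 'X * ('X^m)%:P).
Proof. by rewrite /qpoch big_ord_recr. Qed.

Lemma unit_qpoch m : fps_of_poly (qpoch m) \is a GRing.unit.
Proof.
rewrite rmorph_prod; apply: rpred_prod => i _.
rewrite unfold_in /= /fps_unit /= coefB coef1 coefXM subr0.
exact: unitr1.
Qed.

Section Words.
Variables (X : eqType) (lt : rel X).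
Implicit Types (x y z : X) (T w : seq X).

(** The weight t^des q^rmaj of w, read after the letter x.  A descent into a
    suffix of length k has k = n - i when i is its position in a word of length
    n, so the weight can be computed from the suffixes alone. *)
Fixpoint word_stat x w : {poly {poly rat}} :=
  if w is y :: w' then
    (if lt y x then 'X * ('X^(size w))%:P else 1) * word_stat y w'
  else 1.

Lemma word_stat_iota (p : nat -> X) n :
  word_stat (p 0%N) [seq p i.+1 | i <- iota 0 n]
  = \prod_(i < n) (if lt (p i.+1) (p i) then 'X * ('X^(n - i))%:P else 1).
Proof.
elim: n p => [|n IHn] p; first by rewrite big_ord0.
rewrite big_ord_recl /= size_map size_iota subn0; congr (_ * _).
rewrite -[1%N]addn0 iotaDl -map_comp.
exact: (IHn (fun i => p i.+1)).
Qed.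

(** The coefficient at s is the generating function, by q to the sum of the
    values, of the maps T -> {0, ..., s} that are positive on the letters below
    x: sorting the letters by such values and then by lt is MacMahon's way to
    read off a word. *)
Definition slot_series x T : {fps {poly rat}} :=
  Fps (fun s => \prod_(y <- T) (qint s.+1 - (lt y x)%:R)).

Hypotheses (lt_irr : irreflexive lt) (lt_trans : transitive lt).
Hypothesis lt_total : forall x y, x != y -> lt x y || lt y x.

Lemma coef_slot_series x T s :
  slot_series x T s = \prod_(y <- T) (qint s.+1 - (lt y x)%:R).
Proof. by []. Qed.

(** The recursion by first letter.  At t^s, with A = [s+1]_q and n = |T|, the
    letters y above x contribute prod (A - [z < x]) - prod (A - 1) and those
    below x contribute q^n (prod B - prod (B - [z < x])) with B = [s]_q; the
    middle products cancel since A - 1 = q B. *)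
Lemma slot_series_rec x T : uniq T -> x \notin T -> (0 < size T)%N ->
  fps_of_poly (1 - 'X * ('X^(size T))%:P) * slot_series x T
  = \sum_(y <- T) fps_of_poly (if lt y x then 'X * ('X^(size T))%:P else 1)
      * slot_series y (rem y T).
Proof.
move=> uT xT T_gt0; set t' := 'X * _.
apply: fpsP => s; rewrite fps_sumE rmorphB rmorph1 mulrBl mul1r.
have -> : (slot_series x T - fps_of_poly t' * slot_series x T) s
  = slot_series x T s - (fps_of_poly t' * slot_series x T) s by [].
rewrite coef_fps_of_XCM.
transitivity
  (\sum_(y <- T) (if lt y x then 0 else slot_series y (rem y T) s) +
   \sum_(y <- T) (if lt y x then
       (fps_of_poly t' * slot_series y (rem y T)) s else 0)); last first.
  rewrite -big_split; apply: eq_bigr => y _.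
  by case: ifP => _; [exact: add0r | rewrite rmorph1 mul1r; exact: addr0].
rewrite [X in _ = X + _]
  (sum_prod_above lt_irr lt_trans lt_total (qint s.+1) uT xT).
rewrite coef_slot_series.
case: s => [|s].
  (* Only the letters above x contribute, and A - 1 = [1]_q - 1 = 0: this is
     where T must be nonempty. *)
  rewrite subr0 [X in _ = _ + X]big1 ?addr0; last first.
    by move=> y _; case: ifP => // _; rewrite coef_fps_of_XCM.
  rewrite qintS /qint big_ord0 mulr0 addr0 subrr.
  case: T T_gt0 {uT xT t'} => // z T _.
  by rewrite [X in _ - X]big_cons mul0r subr0.
under [X in _ = _ + X]eq_bigr do rewrite coef_fps_of_XCM.
have prodX : \prod_(z <- T) 'X = 'X^(size T) :> {poly rat}.
  by rewrite big_const_seq count_predT iter_mulr_1.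
have -> : \prod_(z <- T) (qint s.+2 - 1)
  = 'X^(size T) * \prod_(z <- T) qint s.+1.
  rewrite -prodX -big_split; apply: eq_bigr => z _ /=.
  by rewrite (qintS s.+1) addrC addKr.
have -> : \sum_(y <- T) (if lt y x then
    'X^(size T) * slot_series y (rem y T) s else 0) = 'X^(size T) *
  (\prod_(z <- T) qint s.+1 - \prod_(z <- T) (qint s.+1 - (lt z x)%:R)).
  rewrite -(sum_prod_below lt_irr lt_trans lt_total) // big_distrr.
  by apply: eq_bigr => y _; case: ifP; rewrite /= ?mulr0.
rewrite -!coef_slot_series mulrBr; ring.
Qed.

(** Induction on T by the first letter of w.  It becomes the letter with which
    the rest of the word is compared, which is why x has to be arbitrary. *)
Lemma sum_word_stat x T : uniq T -> x \notin T ->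
  fps_of_poly (\sum_(w <- permutations T) word_stat x w)
  = fps_of_poly (qpoch (size T).+1) * slot_series x T.
Proof.
move sizeT: (size T) => n; elim: n x T sizeT => [|n IHn] x T sizeT uT xT.
  rewrite (size0nil sizeT) big_seq1 /qpoch big_ord_recl big_ord0 mulr1.
  apply: fpsP => s; rewrite rmorphB !rmorph1 mulrBl mul1r.
  have -> :
    (slot_series x [::] - fps_of_poly ('X * 1%:P) * slot_series x [::]) s
    = 1 - (fps_of_poly ('X * 1%:P) * slot_series x [::]) s.
    by rewrite /= big_nil.
  rewrite coef_fps_of_XCM; case: s => [|s] /=; first by rewrite subr0.
  by rewrite big_nil mulr1 subrr.
have T_gt0 : (0 < size T)%N by rewrite sizeT.
have size_rem y : y \in T -> size (rem y T) = n.
  by move=> yT; rewrite size_rem // sizeT.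
rewrite (perm_big _ (permutationsE T_gt0)) /= big_allpairs_dep undup_id //.
rewrite qpochS rmorphM -mulrA -sizeT slot_series_rec // rmorph_sum big_distrr.
apply: eq_big_seq => y yT /=; rewrite mulrCA sizeT -IHn ?size_rem ?rem_uniq //.
  rewrite -rmorphM big_distrr /=; congr fps_of_poly.
  apply: eq_big_seq => w; rewrite mem_permutations => /perm_size ->.
  by rewrite size_rem.
by rewrite mem_rem_uniq // !inE eqxx.
Qed.

End Words.

(** * Colored permutations as words *)

Section ColoredPermutations.
Variables (a : nat) (a_gt0 : (0 < a)%N) (n : nat).
Implicit Types (s : {perm letter a n}) (c : {ffun 'I_n -> 'I_a}) (p : 'S_n).

Local Notation "0_c" := (color0 a_gt0).

Lemma rotate_color0 v (j : 'I_n) : rotate a_gt0 v (0_c, j) = (v, j).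
Proof. by congr (_, _); apply: val_inj; rewrite /= addn0 modn_small. Qed.

Lemma rotate0 (x : letter a n) : rotate a_gt0 0_c x = x.
Proof.
by case: x => v j; congr (_, _); apply: val_inj; rewrite /= add0n modn_small.
Qed.

Lemma rotate_transitive (x y : letter a n) :
  x.2 = y.2 -> exists w, rotate a_gt0 w x = y.
Proof.
case: x y => [u i] [v j] /= ->.
exists (Ordinal (ltn_pmod (v + (a - u)) a_gt0)).
congr (_, _); apply: val_inj => /=.
by rewrite modnDml -addnA subnK 1?ltnW // modnDr modn_small.
Qed.

Lemma rotate_inj (x : letter a n) : injective (fun w => rotate a_gt0 w x).
Proof.
move=> v w [] /eqP; rewrite eqn_modDr !modn_small // => /eqP; exact: val_inj.
Qed.

(** The colors are indexed by the letters and not by their positions: the set of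
    letters (c k, k) in the window is then determined by c alone. *)
Definition colored_fun c p (x : letter a n) : letter a n :=
  rotate a_gt0 x.1 (c (p x.2), p x.2).

Lemma colored_fun_inj c p : injective (colored_fun c p).
Proof.
move=> [v i] [w j] e; have /perm_inj eij : p i = p j by case: e.
by rewrite eij in e *; congr (_, _); exact: rotate_inj e.
Qed.

Definition colored_perm (cp : {ffun 'I_n -> 'I_a} * 'S_n) : {perm letter a n} :=
  perm (@colored_fun_inj cp.1 cp.2).

Lemma colored_perm0 c p j :
  colored_perm (c, p) (0_c, j) = (c (p j), p j).
Proof. by rewrite permE /colored_fun rotate0. Qed.

Lemma colored_perm_inj : injective colored_perm.
Proof.
move=> [c p] [c' p'] /permP e.
have ep : p = p'.
  by apply/permP => j; have := e (0_c, j); rewrite !colored_perm0 => -[].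
congr (_, _) => //; apply/ffunP => k.
by have := e (0_c, (p^-1)%g k); rewrite !colored_perm0 -ep permKV => -[].
Qed.

(** A colored permutation s is determined by the letters s (0_c, j).  Their
    absolute values are distinct: two letters with the same absolute value are
    rotations of each other, and s commutes with rotations. *)
Lemma colored_permsE : colored_perms a_gt0 n = colored_perm @: setT.
Proof.
apply/setP => s; rewrite inE; apply/idP/imsetP => [/'forall_'forall_eqP sC|].
  pose f j := (s (0_c, j)).2.
  have f_inj : injective f.
    move=> i j /rotate_transitive [w]; rewrite -sC => /perm_inj.
    by case.
  pose p := perm f_inj; pose c := [ffun k => (s (0_c, (p^-1)%g k)).1].
  exists (c, p) => //; apply/permP => -[v j].
  rewrite permE /colored_fun /= ffunE permK permE -surjective_pairing.
  by rewrite -sC rotate_color0.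
case=> -[c p] _ ->; apply/'forall_'forall_eqP => w j.
by rewrite rotate_color0 colored_perm0 permE.
Qed.

Lemma sum_permutations (R : nmodType) (X : eqType) (f : 'I_n -> X)
    (F : seq X -> R) : injective f ->
  \sum_(p : 'S_n) F [seq f (p j) | j <- enum 'I_n]
  = \sum_(w <- permutations [seq f j | j <- enum 'I_n]) F w.
Proof.
move=> f_inj; pose W (p : 'S_n) := [seq f (p j) | j <- enum 'I_n].
rewrite -(big_map W xpredT F); apply: perm_big; apply: uniq_perm.
- rewrite map_inj_uniq ?index_enum_uniq // => p p' /eq_in_map e.
  by apply/permP => j; apply/f_inj/e; rewrite mem_enum.
- exact: permutations_uniq.
move=> w; rewrite mem_permutations.
have -> : [seq f j | j <- enum 'I_n] = [tuple f j | j < n].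
  by [].
apply/mapP/tuple_permP => [[p _ ->]|[p ->]]; exists p;
  rewrite ?mem_index_enum //.
  by apply: eq_map => j; rewrite tnth_mktuple.
by apply: eq_map => j; rewrite tnth_mktuple.
Qed.

Variable lt : rel (option (letter a n)).

Lemma des_rmaj_word_stat s :
  'X^(des a_gt0 lt s) * ('X^(rmaj a_gt0 lt s))%:P
  = word_stat lt None [seq Some (s (0_c, j)) | j <- enum 'I_n].
Proof.
have -> : [seq Some (s (0_c, j)) | j <- enum 'I_n]
          = [seq window a_gt0 s i.+1 | i <- iota 0 n].
  rewrite -val_enum_ord -map_comp; apply: eq_map => j /=.
  by rewrite valK.
rewrite -[None]/(window a_gt0 s 0) (word_stat_iota lt (window a_gt0 s)).
rewrite -big_mkcond (eq_bigl (mem (Des a_gt0 lt s))); last first.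
  by move=> i; rewrite !inE.
by rewrite big_split /= prodr_const -rmorph_prod prodrXr.
Qed.

Lemma majA_words :
  majA a_gt0 lt = \sum_(c : {ffun 'I_n -> 'I_a})
    \sum_(w <- permutations [seq Some (c j, j) | j <- enum 'I_n])
      word_stat lt None w.
Proof.
rewrite /majA; under eq_bigr do rewrite des_rmaj_word_stat.
rewrite colored_permsE big_imset /=; last by move=> *; exact: colored_perm_inj.
rewrite (eq_bigl xpredT) => [|cp]; last by rewrite in_setT.
rewrite -(pair_bigA _ (fun c p =>
  word_stat lt None
    [seq Some (colored_perm (c, p) (0_c, j)) | j <- enum 'I_n])).
apply: eq_bigr => c _ /=; rewrite -sum_permutations => [|i j [] //].
apply: eq_bigr => p _; congr (word_stat _ _ _); apply: eq_map => j.
by rewrite colored_perm0.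
Qed.

(** For a fixed coloring c the words contribute prod_j ([m+1]_q - [c j in L]) to
    the coefficient of t^m in the quotient.  By distributivity these products
    add up to a product of n equal sums over the colors, each of them
    a[m+1]_q - #|L|. *)
Lemma majA_series (L : {set 'I_a}) : colored_order L lt ->
  fps_of_poly (majA a_gt0 lt) / fps_of_poly (qpoch n.+1)
  = Fps (fun m => (a%:R * qint m.+1 - #|L|%:R) ^+ n).
Proof.
case=> lt_irr lt_trans lt_total lt_L0 lt_0U _ _.
have lt0 v j : lt (Some (v, j)) None = (v \in L).
  case: (boolP (v \in L)) => [/lt_L0 -> //|/lt_0U lt_0v].
  exact: (strict_asym lt_irr lt_trans (lt_0v j)).
apply: (canLR (mulrK (unit_qpoch _))); rewrite mulrC majA_words rmorph_sum.
transitivity (\sum_(c : {ffun 'I_n -> 'I_a}) fps_of_poly (qpoch n.+1)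
    * slot_series lt None [seq Some (c j, j) | j <- enum 'I_n]).
  apply: eq_bigr => c _; rewrite [LHS](sum_word_stat lt_irr lt_trans lt_total).
  - by rewrite size_map size_enum_ord.
  - by rewrite map_inj_uniq ?enum_uniq // => i j [].
  - by apply/mapP => -[].
rewrite -big_distrr /=; congr (_ * _); apply: fpsP => m.
rewrite fps_sumE /=; under eq_bigr => c _.
  rewrite big_map big_enum /=; under eq_bigr do rewrite lt0; over.
rewrite -(bigA_distr_bigA (fun _ v => qint m.+1 - (v \in L)%:R)) /=.
rewrite prodr_const card_ord; congr (_ ^+ _).
rewrite sumrB sumr_const card_ord -[_ *+ a]mulr_natl; congr (_ - _).
rewrite -sum1_card natr_sum [RHS]big_mkcond.
by apply: eq_bigr => v _; case: (v \in L).
Qed.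

End ColoredPermutations.

(** * Exponential generating series *)

Lemma invr_natr_fps (R : comUnitRingType) k :
  k%:R \is a @GRing.unit R -> k%:R^-1 = fpsC (k%:R^-1) :> {fps R}.
Proof. by move=> Uk; rewrite rmorphV //= rmorph_nat. Qed.

Lemma unit_natr_fps (R : comUnitRingType) k :
  k%:R \is a @GRing.unit R -> k%:R \is a @GRing.unit {fps R}.
Proof. by move=> Uk; rewrite -[k%:R](rmorph_nat (@fpsC R)) rmorph_unit. Qed.

Lemma unit_fact_poly (F : numFieldType) n : n`!%:R \is a @GRing.unit {poly F}.
Proof.
by rewrite -polyC_natr rmorph_unit // unitfE pnatr_eq0 -lt0n fact_gt0.
Qed.

Theorem corollary4p5 (a l : nat) (a_gt0 : (0 < a)%N) (le_la : (l <= a)%N)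
    (L : {set 'I_a}) (cardL : #|L| = l)
    (lt : forall n : nat, rel (option (letter a n)))
    (ltL : forall n : nat, colored_order L (lt n)) :
  exists S : {fps {fps {poly rat}}},
    fps_has_sum
      (fun n : nat => fpsX ^+ n / n`!%:R *
         fpsC (fps_of_poly (majA a_gt0 (lt n)) / fps_of_poly (qpoch n.+1))) S
    /\ fps_has_sum
      (fun s : nat => fpsC (fpsX ^+ s) *
         fps_exp (fpsC (a%:R * qint s.+1 - l%:R))) S.
Proof.
pose c n m := (a%:R * qint m.+1 - l%:R) ^+ n / n`!%:R : {poly rat}.
have Ufact i : i`!%:R \is a @GRing.unit {poly rat} by exact: unit_fact_poly.
have factV i := invr_natr_fps (Ufact i).
have factVV i := invr_natr_fps (unit_natr_fps (Ufact i)).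
exists (Fps (fun n => Fps (c n))); split=> n m.
  have coef_n i : (fpsX ^+ i / i`!%:R *
      fpsC (fps_of_poly (majA a_gt0 (lt i)) / fps_of_poly (qpoch i.+1))) n m
    = if i == n then c n m else 0.
    rewrite (majA_series a_gt0 (ltL i)) cardL factVV -mulrA coef_fpsXnM.
    case: ltngtP => [lt_in|//|->]; rewrite coef_fpsCM.
      by rewrite -subnSK // [fps_coef (fpsC _) _]/= mulr0.
    by rewrite subnn [fps_coef (fpsC _) 0]/= factV coef_fpsCM mulrC.
  exists n.+1 => k lt_nk; rewrite !fps_sumE.
  under eq_bigr do rewrite coef_n.
  by rewrite -big_mkcond (big_pred1 (Ordinal lt_nk)).
have coef_m i : (fpsC (fpsX ^+ i) *
    fps_exp (fpsC (a%:R * qint i.+1 - l%:R))) n m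
  = if i == m then c n m else 0.
  rewrite coef_fpsCM coef_fpsXnM [fps_coef (fps_exp _) n]/= factV.
  rewrite -rmorphXn -rmorphM; case: ltngtP => [lt_im|//|->].
    by rewrite -subnSK.
  by rewrite subnn.
exists m.+1 => k lt_mk; rewrite !fps_sumE.
under eq_bigr do rewrite coef_m.
by rewrite -big_mkcond (big_pred1 (Ordinal lt_mk)).
Qed.
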